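(* Let $d$ be a homogeneous distance on $\mathbb{H}$ with profile $\phi: K \rightarrow [0,+\infty)$. Assume that BCP holds in $(\mathbb{H},d)$. Then there is a countable closed set $W\subset\mathbb{S}^1$ such that $\mathbb{S}^1 \setminus W$ can be written as a countable union of relatively open subsets $O_j$, and, for each $j$, there are $m_j>0$ and $\alpha_j \in (0,\pi/2)$ such that, for all $v\in \operatorname{int}(K) \setminus \{0\}$ such that $\phi$ is differentiable at $v$ and $v/\|v\| \in O_j$, we have, for all $w\in\mathbb{R}^2\setminus\{0\}$, $$\measuredangle (v,w) \leq \alpha_j \ \Rightarrow\ \langle \nabla\phi(v) , w \rangle \le - m_j \|v\|\|w\|.$$ Furthermore, $\phi(0) = \max \{\phi(v): v \in K\}$ and $\phi$ is differentiable at $0$ with $\nabla \phi(0) = 0$.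
   Context: The first Heisenberg group $\mathbb{H}$ is $\mathbb{R}^2\times\mathbb{R}$ with group law $(v,z)\cdot(v',z') := (v+v', z+z'+\omega(v,v')/2)$, where $\omega(v,v') := v_1v'_2-v_2v'_1$, and dilations $\delta_t(v,z) := (tv,t^2z)$, $t\ge 0$. A distance $d$ on $\mathbb{H}$ is homogeneous if it is left-invariant ($d(p\cdot q,p\cdot q')=d(q,q')$) and $d(\delta_t(p),\delta_t(q))=t\,d(p,q)$ for all $t>0$. Such a distance induces the Euclidean topology. Profile: let $B:=\{p\in\mathbb{H}: d(0,p)\le 1\}$ be the closed unit ball of a homogeneous distance $d$ centered at the origin, $\pi(v,z):=v$ and $K:=\pi(B)$. It is known that $K\subset\mathbb{R}^2$ is compact, convex, $K=-K$, $0\in\operatorname{int}(K)$, and that there is a (unique) bounded function $\phi:K\to[0,+\infty)$, locally Lipschitz on $\operatorname{int}(K)$, such that $B=\{(v,z)\in\mathbb{H}: v\in K,\ -\phi(-v)\le z\le\phi(v)\}$. This $\phi$ is called the profile of $d$. $\langle\cdot,\cdot\rangle$ and $\|\cdot\|$ are the Euclidean scalar product and norm; $\measuredangle(v,w):=\arccos\frac{\langle v,w\rangle}{\|v\|\|w\|}\in[0,\pi]$ is the unoriented angle between nonzero vectors; $\mathbb{S}^1$ is the Euclidean unit circle in $\mathbb{R}^2$. BCP: in a metric space, balls are closed balls $B(p,r)=\{q: d(p,q)\le r\}$, $0<r<\infty$ (a ball comes with its center and radius). A family $\mathcal{B}$ of balls is a Besicovitch family if the center of each $B\in\mathcal{B}$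 belongs to no other $B'\in\mathcal{B}$, $B'\ne B$, and $\bigcap_{B\in\mathcal{B}}B\neq\emptyset$. The space satisfies the Besicovitch Covering Property (BCP) if there is a constant $C\ge1$ such that $\operatorname{Card}\mathcal{B}\le C$ for every Besicovitch family $\mathcal{B}$ of balls. *)

(* Defs.v *)
From HB Require Import structures.
From mathcomp Require Import all_boot all_order all_algebra.
From mathcomp Require Import all_classical all_reals all_analysis.

Set Implicit Arguments.
Unset Strict Implicit.
Unset Printing Implicit Defensive.

Import Order.TTheory GRing.Theory Num.Theory.
Import numFieldNormedType.Exports.

Local Open Scope classical_set_scope.
Local Open Scope ring_scope.

(* The normed-module structure of the library on ['rV[R]_2] is the sup norm
   [`|v|]. It gives the usual topology, differentiability and local Lipschitz
   condition of R^2; the Euclidean norm is [enorm]. *)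

Definition dot (R : realType) (v w : 'rV[R]_2) : R :=
  \sum_(i < 2) v 0 i * w 0 i.

Definition enorm (R : realType) (v : 'rV[R]_2) : R := Num.sqrt (dot v v).

Definition angle (R : realType) (v w : 'rV[R]_2) : R :=
  acos (dot v w / (enorm v * enorm w)).

Definition unit_circle (R : realType) : set 'rV[R]_2 := [set v | enorm v = 1].
Arguments unit_circle R : clear implicits.

Definition rel_open (T : topologicalType) (S A : set T) : Prop :=
  exists2 U : set T, open U & A = S `&` U.

Definition gradient (R : realType) (f : 'rV[R]_2 -> R) (v : 'rV[R]_2) :
    'rV[R]_2 :=
  \row_(i < 2) 'D_(delta_mx 0 i) f v.

Definition is_distance (R : realType) (T : Type) (d : T -> T -> R) : Prop :=
  [/\ forall p q, 0 <= d p q,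
      forall p q, d p q = 0 <-> p = q,
      forall p q, d p q = d q p &
      forall p q r, d p r <= d p q + d q r].

Definition cball (R : realType) (T : Type) (d : T -> T -> R) (p : T) (r : R) :
    set T :=
  [set q | d p q <= r].

(* A ball is the pair (center, radius). *)
Definition besicovitch_family (R : realType) (T : Type) (d : T -> T -> R)
    (F : set (T * R)) : Prop :=
  [/\ forall b, F b -> 0 < b.2,
      forall b b', F b -> F b' -> b' <> b -> ~ cball d b'.1 b'.2 b.1 &
      \bigcap_(b in F) cball d b.1 b.2 !=set0].

Definition BCP (R : realType) (T : Type) (d : T -> T -> R) : Prop :=
  exists2 C : nat, (1 <= C)%N &
    forall F : set (T * R), besicovitch_family d F -> (F #<= `I_C)%card.

Definition Heis (R : realType) : Type := ('rV[R]_2 * R)%type.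

Definition omega (R : realType) (v w : 'rV[R]_2) : R :=
  v 0 0 * w 0 1 - v 0 1 * w 0 0.

Definition heis_mul (R : realType) (p q : Heis R) : Heis R :=
  (p.1 + q.1, p.2 + q.2 + omega p.1 q.1 / 2).

Definition heis_dil (R : realType) (t : R) (p : Heis R) : Heis R :=
  (t *: p.1, t ^+ 2 * p.2).

Definition homogeneous_distance (R : realType) (d : Heis R -> Heis R -> R) :
    Prop :=
  [/\ is_distance d,
      forall p q q', d (heis_mul p q) (heis_mul p q') = d q q' &
      forall t p q, 0 < t -> d (heis_dil t p) (heis_dil t q) = t * d p q].

Definition unit_ball (R : realType) (d : Heis R -> Heis R -> R) :
    set (Heis R) :=
  cball d (0, 0) 1.

Definition shadow (R : realType) (d : Heis R -> Heis R -> R) : set 'rV[R]_2 :=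
  fst @` unit_ball d.

(* A function on [shadow d] is represented by a total function whose values
   elsewhere are irrelevant: [- p.1] is in the shadow when [p.1] is. *)
Definition is_profile (R : realType) (d : Heis R -> Heis R -> R)
    (phi : 'rV[R]_2 -> R) : Prop :=
  [/\ forall v, shadow d v -> 0 <= phi v,
      [bounded phi v | v in shadow d],
      forall v, (shadow d)° v ->
        exists2 U : set 'rV[R]_2, nbhs v U & [lipschitz phi w | w in U] &
      unit_ball d =
        [set p | shadow d p.1 /\ - phi (- p.1) <= p.2 <= phi p.1]].

(* Main.v *)
(* Points p_1, ..., p_n of the unit ball such that, for i < j, p_i is at distance more
   than 1 from all small dilations of p_j yield, after dilating p_i by eps^i, n balls
   forming a Besicovitch family; so BCP bounds n.

   To first order, the point of the unit sphere over v is at distance more than 1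
   from small dilations of a point over w when grad phi(v).w + omega(v,w)/2 > 0 (and
   with a minus sign for the bottom of the sphere).  A constant sequence of points
   gives grad phi(v).v <= 0, and more generally phi is nonincreasing along rays.
   If the required slope bound fails near a direction e, then at suitable points
   over directions close to e one of these two functionals is positive on almost the
   whole half-plane on a fixed side of v.  Ordering such directions by angle inside a
   half-plane gives chains of points, so there are only finitely many exceptional
   directions: W is in fact finite.

   Finally, if phi were not flat at 0, the unit ball would have an outgoing corner at
   its pole in some direction e.  Larger and larger dilated copies of the pole, each
   tilted slightly towards -e, then form arbitrarily large Besicovitch families. *)

Require Import Defs.
From HB Require Import structures.
From mathcomp Require Import all_boot all_order all_algebra.
From mathcomp Require Import all_classical all_reals all_analysis.
From mathcomp Require Import ring lra.

Set Implicit Arguments.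
Unset Strict Implicit.
Unset Printing Implicit Defensive.

Import Order.TTheory GRing.Theory Num.Theory.
Import numFieldNormedType.Exports.

Local Open Scope classical_set_scope.
Local Open Scope ring_scope.

(** * The Heisenberg group and the homogeneous norm *)

Section Heisenberg.
Context {R : realType}.
Implicit Types (p q r : Heis R) (v w u : 'rV[R]_2) (t x y z : R).

Definition heis_inv p : Heis R := (- p.1, - p.2).

Lemma omegavv v : omega v v = 0. Proof. by rewrite /omega; ring. Qed.
Lemma omegaNl v w : omega (- v) w = - omega v w.
Proof. by rewrite /omega !mxE; ring. Qed.
Lemma omegaNr v w : omega v (- w) = - omega v w.
Proof. by rewrite /omega !mxE; ring. Qed.
Lemma omegaZl t v w : omega (t *: v) w = t * omega v w.
Proof. by rewrite /omega !mxE; ring. Qed.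
Lemma omegaZr t v w : omega v (t *: w) = t * omega v w.
Proof. by rewrite /omega !mxE; ring. Qed.
Lemma omegaDl u v w : omega (u + v) w = omega u w + omega v w.
Proof. by rewrite /omega !mxE; ring. Qed.
Lemma omegaDr u v w : omega u (v + w) = omega u v + omega u w.
Proof. by rewrite /omega !mxE; ring. Qed.
Lemma omega0v v : omega 0 v = 0. Proof. by rewrite /omega !mxE; ring. Qed.
Lemma omegav0 v : omega v 0 = 0. Proof. by rewrite /omega !mxE; ring. Qed.
Definition omegaE := (omegavv, omegaNl, omegaNr, omegaZl, omegaZr, omegaDl,
  omegaDr, omega0v, omegav0).

Lemma heis_mulA p q r : heis_mul p (heis_mul q r) = heis_mul (heis_mul p q) r.
Proof.
rewrite /heis_mul /=; congr pair; first by rewrite addrA.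
by rewrite !omegaE; ring.
Qed.

Lemma heis_mulVK p q : heis_mul (heis_inv p) (heis_mul p q) = q.
Proof.
case: q => v z; rewrite heis_mulA /heis_mul /heis_inv /= addNr add0r.
by rewrite !omegaE; congr pair; ring.
Qed.

Lemma heis_mulVp p : heis_mul (heis_inv p) p = (0, 0).
Proof. by rewrite /heis_mul /= addNr !omegaE; congr pair; ring. Qed.

Lemma heis_mulp0 p : heis_mul p (0, 0) = p.
Proof. by case: p => v z; rewrite /heis_mul /= addr0 !omegaE; congr pair; ring. Qed.

Lemma heis_dilA s t p : heis_dil s (heis_dil t p) = heis_dil (s * t) p.
Proof. by rewrite /heis_dil /= scalerA exprMn mulrA. Qed.

Lemma heis_dil0 t : heis_dil t (0, 0) = (0, 0) :> Heis R.
Proof. by rewrite /heis_dil /= scaler0 mulr0. Qed.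

Lemma row2E v : v = v 0 0 *: delta_mx 0 0 + v 0 1 *: delta_mx 0 1.
Proof.
apply/rowP => i; rewrite !mxE !eqxx /=.
by case: i => [[|[|//]]] Hi /=; rewrite ?mulr1 ?mulr0 ?addr0 ?add0r;
  congr (v _ _); apply: val_inj.
Qed.

(** * Continuity of the group operations *)

Section Continuity.
Context {T : Type} {F : set_system T} {FF : Filter F}.

Lemma cvg_coord {i : 'I_2} (f : T -> 'rV[R]_2) v :
  f x @[x --> F] --> v -> f x 0 i @[x --> F] --> v 0 i.
Proof.
move=> fv; apply: (@continuous_cvg _ _ _ _ _ _ (fun u : 'rV[R]_2 => u 0 i)) fv.
exact: coord_continuous.
Qed.

Lemma cvg_omega (f g : T -> 'rV[R]_2) v w :
  f x @[x --> F] --> v -> g x @[x --> F] --> w ->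
  omega (f x) (g x) @[x --> F] --> omega v w.
Proof. by move=> fv gw; apply: cvgB; apply: cvgM; exact: cvg_coord. Qed.

Lemma cvg_heis_mul (f g : T -> Heis R) p q :
  f x @[x --> F] --> p -> g x @[x --> F] --> q ->
  heis_mul (f x) (g x) @[x --> F] --> heis_mul p q.
Proof.
move=> fp gq.
have f1 : (f x).1 @[x --> F] --> p.1 by apply: cvg_comp fp _; exact: cvg_fst.
have f2 : (f x).2 @[x --> F] --> p.2 by apply: cvg_comp fp _; exact: cvg_snd.
have g1 : (g x).1 @[x --> F] --> q.1 by apply: cvg_comp gq _; exact: cvg_fst.
have g2 : (g x).2 @[x --> F] --> q.2 by apply: cvg_comp gq _; exact: cvg_snd.
apply: (cvg_pair (G := nbhs (p.1 + q.1))
  (H := nbhs (p.2 + q.2 + omega p.1 q.1 / 2))); first exact: cvgD.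
by apply: cvgD; [exact: cvgD|apply: cvgMl; exact: cvg_omega].
Qed.

Lemma cvg_heis_dil (f : T -> Heis R) t p :
  f x @[x --> F] --> p -> heis_dil t (f x) @[x --> F] --> heis_dil t p.
Proof.
move=> fp.
have f1 : (f x).1 @[x --> F] --> p.1 by apply: cvg_comp fp _; exact: cvg_fst.
have f2 : (f x).2 @[x --> F] --> p.2 by apply: cvg_comp fp _; exact: cvg_snd.
apply: (cvg_pair (G := nbhs (t *: p.1)) (H := nbhs (t ^+ 2 * p.2))).
  exact: cvgZr.
exact: cvgMr.
Qed.

End Continuity.

(** * The norm attached to a homogeneous distance *)

Section Distance.
Variable d : Heis R -> Heis R -> R.
Hypothesis d_homogeneous : homogeneous_distance d.

Let d_ge0 p q : 0 <= d p q.
Proof. by case: d_homogeneous => -[]. Qed.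

Let d_sym p q : d p q = d q p.
Proof. by case: d_homogeneous => -[]. Qed.

Let d_triangle p q r : d p r <= d p q + d q r.
Proof. by case: d_homogeneous => -[]. Qed.

Let d_left p q r : d (heis_mul p q) (heis_mul p r) = d q r.
Proof. by case: d_homogeneous. Qed.

Let d_dil t p q : 0 < t -> d (heis_dil t p) (heis_dil t q) = t * d p q.
Proof. by case: d_homogeneous => _ _; apply. Qed.

Definition heis_norm p := d (0, 0) p.

Lemma dist_norm p q : d p q = heis_norm (heis_mul (heis_inv p) q).
Proof. by rewrite -(d_left (heis_inv p)) heis_mulVp. Qed.

Lemma heis_norm_ge0 p : 0 <= heis_norm p. Proof. exact: d_ge0. Qed.

Lemma heis_normV p : heis_norm (heis_inv p) = heis_norm p.
Proof. by rewrite -[heis_inv p]heis_mulp0 -dist_norm d_sym. Qed.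

Lemma heis_norm0 : heis_norm (0, 0) = 0.
Proof. by case: d_homogeneous => -[_ H _ _ _ _]; apply/H. Qed.

Lemma heis_norm_dil t p : 0 < t -> heis_norm (heis_dil t p) = t * heis_norm p.
Proof. by move=> t0; rewrite -d_dil// heis_dil0. Qed.

Lemma heis_norm_mul p q :
  heis_norm (heis_mul p q) <= heis_norm p + heis_norm q.
Proof.
apply: le_trans (d_triangle _ p _) _; rewrite lerD2l.
by rewrite dist_norm heis_mulVK.
Qed.

Lemma heis_norm_horizontal t v :
  heis_norm (t *: v, 0) = `|t| * heis_norm (v, 0).
Proof.
have pos (s : R) : 0 < s -> heis_norm (s *: v, 0) = s * heis_norm (v, 0).
  by move=> s0; rewrite -heis_norm_dil// /heis_dil /= mulr0.
case: (ltrgtP t 0) => [t0|t0|->].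
- by rewrite -heis_normV /heis_inv /= oppr0 -scaleNr pos ?oppr_gt0// ltr0_norm.
- by rewrite pos// gtr0_norm.
- by rewrite scale0r heis_norm0 normr0 mul0r.
Qed.

Lemma heis_norm_vertical z :
  heis_norm (0, z) = Num.sqrt `|z| * heis_norm (0, 1).
Proof.
have pos (s : R) : 0 < s -> heis_norm (0, s) = Num.sqrt s * heis_norm (0, 1).
  move=> s0; rewrite -heis_norm_dil ?sqrtr_gt0// /heis_dil /= scaler0 mulr1.
  by rewrite sqr_sqrtr// ltW.
case: (ltrgtP z 0) => [z0|z0|->].
- by rewrite -heis_normV /heis_inv /= oppr0 pos ?oppr_gt0// ltr0_norm.
- by rewrite pos// gtr0_norm.
- by rewrite normr0 sqrtr0 heis_norm0 mul0r.
Qed.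

(** The point factors into two horizontal coordinate vectors and a vertical one, each of explicit
    norm. This is the source of the continuity of [d] for the usual topology. *)
Lemma heis_norm_le p : heis_norm p <=
  `|p.1 0 0| * heis_norm (delta_mx 0 0, 0) +
  `|p.1 0 1| * heis_norm (delta_mx 0 1, 0) +
  Num.sqrt `|p.2 - p.1 0 0 * p.1 0 1 / 2| * heis_norm (0, 1).
Proof.
case: p => v z /=.
set a := v 0 0; set b := v 0 1.
have -> : (v, z) = heis_mul (heis_mul (a *: delta_mx 0 0, 0)
    (b *: delta_mx 0 1, 0)) (0, z - a * b / 2) :> Heis R.
  rewrite /heis_mul /=; congr pair; first by rewrite addr0 -row2E.
  by rewrite !omegaE /omega !mxE /=; field.
rewrite -heis_norm_vertical -!heis_norm_horizontal.
apply: le_trans (heis_norm_mul _ _) _; rewrite lerD2r.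
exact: heis_norm_mul.
Qed.

Lemma heis_norm_cvg0 : heis_norm p @[p --> (0, 0) : Heis R] --> (0 : R).
Proof.
apply: (@squeeze_cvgr _ _ _ _ (fun=> 0) (fun p : Heis R =>
  `|p.1 0 0| * heis_norm (delta_mx 0 0, 0) +
  `|p.1 0 1| * heis_norm (delta_mx 0 1, 0) +
  Num.sqrt `|p.2 - p.1 0 0 * p.1 0 1 / 2| * heis_norm (0, 1))).
- by near=> p; rewrite heis_norm_ge0 heis_norm_le.
- exact: cvg_cst.
- have c1 (i : 'I_2) : (fun p : Heis R => p.1 0 i) @ ((0, 0) : Heis R) --> (0 : R).
    have : (fst : Heis R -> _) @ ((0, 0) : Heis R) --> (0 : 'rV[R]_2) by exact: cvg_fst.
    by move=> /(cvg_coord (i := i)); rewrite mxE.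
  have c2 : (snd : Heis R -> _) @ ((0, 0) : Heis R) --> (0 : R) by exact: cvg_snd.
  set f := (F in F @ _ --> _).
  suff : f @ ((0, 0) : Heis R) --> `|0 : R| * heis_norm (delta_mx 0 0, 0) +
      `|0 : R| * heis_norm (delta_mx 0 1, 0) +
      Num.sqrt `|0 - 0 * 0 / 2 : R| * heis_norm (0, 1).
    by rewrite !mul0r subr0 normr0 sqrtr0 !mul0r !addr0.
  apply: cvgD; first by apply: cvgD; apply: cvgMl; apply: cvg_norm.
  apply: cvgMl; apply: (@continuous_cvg _ _ _ _ _ _ Num.sqrt).
    exact: sqrt_continuous.
  apply: cvg_norm; apply: cvgB => //; apply: cvgMl; exact: cvgM.
Unshelve. all: by end_near. Qed.

Lemma heis_norm_continuous : continuous (heis_norm : Heis R -> R).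
Proof.
move=> p; apply/cvgrPdist_lt => e e0.
have c : heis_mul (heis_inv p) q @[q --> p] --> ((0, 0) : Heis R).
  by rewrite -(heis_mulVp p); apply: cvg_heis_mul; [exact: cvg_cst|exact: cvg_id].
have := heis_norm_cvg0; move=> /(cvg_comp _ _ c) /cvgrPdist_lt /(_ _ e0).
apply: filterS => q /=; rewrite sub0r normrN ger0_norm ?heis_norm_ge0// => h.
have := d_triangle (0, 0) q p; have := d_triangle (0, 0) p q.
rewrite (d_sym q) (dist_norm p q) -!/(heis_norm _) => h1 h2.
by rewrite ltr_norml; apply/andP; split; lra.
Qed.

End Distance.
End Heisenberg.

(** * Besicovitch families *)

Lemma near_forall_ltn (T : Type) (F : set_system T) {FF : Filter F} (n : nat)
    (P : nat -> T -> Prop) :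
  (forall i, (i < n)%N -> \forall x \near F, P i x) ->
  \forall x \near F, forall i, (i < n)%N -> P i x.
Proof.
move=> FP; have : \forall x \near F, forall i : 'I_n, P i x.
  by apply: filter_forall => i; exact: FP.
by apply: filterS => x Px i ni; exact: (Px (Ordinal ni)).
Qed.

Lemma near_forall_ltn2 (T : Type) (F : set_system T) {FF : Filter F} (n : nat)
    (P : nat -> nat -> T -> Prop) :
  (forall i j, (i < j < n)%N -> \forall x \near F, P i j x) ->
  \forall x \near F, forall i j, (i < j < n)%N -> P i j x.
Proof.
move=> FP.
have : \forall x \near F, forall j, (j < n)%N -> forall i, (i < j)%N -> P i j x.
  apply: near_forall_ltn => j jn; apply: near_forall_ltn => i ij.
  by apply: FP; rewrite ij.
by apply: filterS => x Px i j /andP[ij jn]; exact: Px.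
Qed.

(** Lets one small ratio [l] serve for all its powers at once. *)
Lemma near_at_right_le (R : realType) (P : R -> Prop) :
  (\forall x \near 0^'+, P x) ->
  \forall x \near 0^'+, forall y, 0 < y <= x -> P y.
Proof.
move=> [e /= e0 eP]; near=> x => y /andP[y0 yx]; apply: eP => //=.
rewrite sub0r normrN gtr0_norm//; apply: le_lt_trans yx _.
by near: x; exact: nbhs_right_lt.
Unshelve. all: by end_near. Qed.

Section Besicovitch.
Context {R : realType} (d : Heis R -> Heis R -> R).
Hypothesis d_homogeneous : homogeneous_distance d.

(** The origin is the common point of the balls, and the maximum says that neither centre lies in
    the other ball. *)
Lemma BCP_bound : BCP d -> exists C : nat, forall n (p : nat -> Heis R) (r : nat -> R),
  (forall i, (i < n)%N -> 0 < r i) ->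
  (forall i, (i < n)%N -> heis_norm d (p i) <= r i) ->
  (forall i j, (i < j < n)%N -> Num.max (r i) (r j) < d (p i) (p j)) ->
  (n <= C)%N.
Proof.
case=> C _ BC; exists C => n p r r_gt0 pr dp.
have dsym a b : d a b = d b a by case: d_homogeneous => -[].
have dp' i j : (i < n)%N -> (j < n)%N -> i != j -> Num.max (r i) (r j) < d (p i) (p j).
  move=> ni nj; rewrite neq_ltn => /orP[ij|ij]; first by apply: dp; rewrite ij.
  by rewrite dsym maxC; apply: dp; rewrite ij.
pose f i := (p i, r i).
rewrite -card_le_II; apply: card_le_trans (BC (f @` `I_n) _).
  have finj : {in `I_n &, injective f}.
    move=> i j /set_mem ni /set_mem nj [pij rij].
    apply/eqP/negPn/negP => /(dp' _ _ ni nj).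
    rewrite pij; case: d_homogeneous => -[_ /(_ (p j) (p j))[_ -> //] _ _ _ _].
    by rewrite gt_max ltNge ltW ?r_gt0.
  by have := inj_card_eq finj; rewrite card_eq_le => /andP[].
split.
- by move=> _ [i ni <-]; exact: r_gt0.
- move=> _ _ [i ni <-] [j nj <-] fij; rewrite /cball /= => h.
  have ij : j != i by apply: contra_notN fij => /eqP ->.
  by have := dp' _ _ nj ni ij; rewrite gt_max ltNge h.
- by exists (0, 0) => _ [i ni <-]; rewrite /cball /= dsym; exact: pr.
Qed.

(** Dilate [p i] by [l ^+ i] and take [l ^+ i] as radius. Rescaled, the pair [i < j] only involves
    the ratio [l ^+ (j - i)], which is at most [l]. *)
Lemma BCP_bound_dil : BCP d -> exists C : nat, forall n (p : nat -> Heis R),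
  (forall i, (i < n)%N -> heis_norm d (p i) <= 1) ->
  (forall i j, (i < j < n)%N ->
    \forall l \near 0^'+, 1 < d (p i) (heis_dil l (p j))) ->
  (n <= C)%N.
Proof.
move=> /BCP_bound[C BC]; exists C => n p p1 dp.
have : \forall l \near (0 : R)^'+, forall i j, (i < j < n)%N ->
    forall m, 0 < m <= l -> 1 < d (p i) (heis_dil m (p j)).
  by apply: near_forall_ltn2 => i j ij; apply: near_at_right_le; exact: dp.
move=> near_p; have [l [l0 l1 lp]] : exists l : R, [/\ 0 < l, l < 1 &
    forall i j, (i < j < n)%N -> forall m, 0 < m <= l -> 1 < d (p i) (heis_dil m (p j))].
  near (0 : R)^'+ => l; exists l; split; near: l; last exact: near_p.
    exact: nbhs_right_gt.
  exact: nbhs_right_lt.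
apply: (BC n (fun i => heis_dil (l ^+ i) (p i)) (fun i => l ^+ i)).
- by move=> i _; rewrite exprn_gt0.
- by move=> i ni; rewrite heis_norm_dil ?exprn_gt0// ler_piMr ?p1// exprn_ge0// ltW.
- move=> i j /[dup] ijn /andP[ij jn].
  rewrite -(subnKC (ltnW ij)) exprD -heis_dilA.
  case: (d_homogeneous) => _ _ ->; last by rewrite exprn_gt0.
  have lji : 0 < l ^+ (j - i) <= l.
    rewrite exprn_gt0//= -[leRHS]expr1 ler_wiXn2l ?subn_gt0// ltW//.
  rewrite gt_max ltr_pMr ?exprn_gt0//; have := lp _ _ ijn _ lji.
  rewrite subnKC ?(ltnW ij)// => h; rewrite h/=.
  rewrite ltr_pM2l ?exprn_gt0//; apply: le_lt_trans h.
  by case/andP: lji => _ /le_trans; apply; exact: ltW.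
Unshelve. all: by end_near. Qed.

End Besicovitch.

(** * Monotonicity of the profile along rays *)

Section Profile.
Context {R : realType} (d : Heis R -> Heis R -> R) (phi : 'rV[R]_2 -> R).
Hypothesis d_homogeneous : homogeneous_distance d.
Hypothesis phi_profile : is_profile d phi.
Implicit Types (p q : Heis R) (v w u : 'rV[R]_2).

Lemma shadow_of_norm p : heis_norm d p <= 1 -> shadow d p.1.
Proof. by move=> p1; exists p. Qed.

Lemma le_profile p : heis_norm d p <= 1 -> p.2 <= phi p.1.
Proof.
move=> p1; case: phi_profile => _ _ _ E.
by have : unit_ball d p by []; rewrite E => -[_ /andP[]].
Qed.

Lemma shadowN v : shadow d v -> shadow d (- v).
Proof.
move=> [p p1 <-]; apply: (@shadow_of_norm (heis_inv p)).
by rewrite heis_normV.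
Qed.

Lemma profile_ge0 v : shadow d v -> 0 <= phi v.
Proof. by case: phi_profile => H _ _ _; exact: H. Qed.

Lemma profile_norm v : shadow d v -> heis_norm d (v, phi v) <= 1.
Proof.
move=> Kv; case: phi_profile => _ _ _ E.
suff : unit_ball d (v, phi v) by [].
rewrite E; split => //=; rewrite lexx andbT.
apply: le_trans (profile_ge0 Kv).
by rewrite oppr_le0; apply/profile_ge0/shadowN.
Qed.

Lemma shadow0 : shadow d 0.
Proof. by apply: (@shadow_of_norm (0, 0)); rewrite heis_norm0. Qed.

Lemma profile_bounded : exists2 M, 0 < M & forall v, shadow d v -> phi v <= M.
Proof.
case: phi_profile => _ /pinfty_ex_gt0[M M0 HM] _ _; exists M => // v /HM /=.
by move=> h; apply: le_trans h; exact: ler_norm.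
Qed.

Lemma dist_dil_self l p : d p (heis_dil l p) =
  heis_norm d ((1 - l) *: p.1, (1 - l ^+ 2) * p.2).
Proof.
have -> : d p (heis_dil l p) = d (heis_dil l p) p by case: d_homogeneous => -[].
rewrite dist_norm//; congr (heis_norm d (_, _)) => /=.
  by rewrite scalerBl scale1r addrC.
by rewrite !omegaE; ring.
Qed.

Lemma shadow_nbhs0 : nbhs (0 : 'rV[R]_2) (shadow d).
Proof.
have : \forall p \near ((0, 0) : Heis R), heis_norm d p < 1.
  have /cvgrPdist_lt /(_ _ ltr01) := heis_norm_cvg0 d_homogeneous.
  apply: filterS => p /=; rewrite sub0r normrN.
  by apply: le_lt_trans; exact: ler_norm.
move=> [[A B] /= [A0 B0]] AB; apply: filterS A0 => v Av.
apply: (@shadow_of_norm (v, 0)); apply/ltW/(AB (v, 0)); split => //=.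
exact: nbhs_singleton.
Qed.

Section BCP.
Hypothesis d_BCP : BCP d.

(** If the profile increased along the ray, a maximum point of the height tilted by a linear term
    would be at distance more than 1 from its own small dilations, and its constant sequence would
    contradict BCP. *)
Lemma profile_ray v t0 : shadow d v -> 0 <= t0 <= 1 -> phi v <= phi (t0 *: v).
Proof.
move=> Kv /andP[t00 t01]; rewrite leNgt; apply/negP => lt_phi.
have [M M0 phiM] := profile_bounded.
pose A : set (R * R) := (`[t0, 1] `*` `[0, M]) `&`
  [set x | heis_norm d (x.1 *: v, x.2) <= 1].
(* Half the gap: at [(1, phi v)] the value of [z - c * t] still exceeds all its values at [t = t0],
   so the maximum has [t > t0]. *)
pose c := (phi v - phi (t0 *: v)) / 2.
have c0 : 0 < c by rewrite divr_gt0// subr_gt0.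
have A1 : A (1, phi v).
  rewrite /A/= !in_itv/= t01 lexx profile_ge0// phiM// scale1r.
  by split => //; exact: profile_norm.
have cA : compact A.
  apply: subclosed_compact (compact_setX (@segment_compact _ t0 1)
    (@segment_compact _ 0 M)) _; last by move=> x [].
  apply: closedI.
    apply: (@closedI _ (fst @^-1` `[t0, 1]) (snd @^-1` `[0, M])).
      by apply: preimage_closed; [move=> x _; exact: cvg_fst|exact: interval_closed].
    by apply: preimage_closed; [move=> x _; exact: cvg_snd|exact: interval_closed].
  apply: (@preimage_closed _ _ (fun x : R * R => heis_norm d (x.1 *: v, x.2))
    [set y | y <= 1]); last exact: closed_le.
  move=> x _; apply: (@continuous_cvg _ _ _ _ _ _ (heis_norm d)).
    exact: heis_norm_continuous.
  apply: (cvg_pair (G := nbhs (x.1 *: v)) (H := nbhs x.2)); last exact: cvg_snd.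
  by apply: cvgZl; exact: cvg_fst.
have [|[t z] /set_mem[[/= ]]] := @compact_EVT_max _ _ (fun x : R * R => x.2 - c * x.1) A
  (ex_intro _ _ A1) cA.
  apply: continuous_subspaceT => x; apply: cvgB; first exact: cvg_snd.
  by apply: cvgMr; exact: cvg_fst.
rewrite !in_itv/= => /andP[tt0 t1] /andP[z0 zM] tz1 tzmax.
have {tzmax} tzmax s y : t0 <= s <= 1 -> 0 <= y -> heis_norm d (s *: v, y) <= 1 ->
    y - c * s <= z - c * t.
  move=> s01 y0 sy1; apply: (tzmax (s, y)); apply/mem_set.
  rewrite /A/= !in_itv/= s01 y0/=; split => //; split => //.
  apply: le_trans (phiM (s *: v) _); first exact: (@le_profile (s *: v, y)).
  exact: (@shadow_of_norm (s *: v, y)).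
have lt_t0t : t0 < t.
  rewrite lt_neqAle tt0 andbT; apply/eqP => t0E.
  have := tzmax 1 (phi v); rewrite t01 lexx scale1r profile_ge0// profile_norm//.
  move=> /(_ erefl erefl erefl); have := le_profile tz1; rewrite /= -t0E.
  rewrite -t0E in tz1; have : 0 <= c * t0 by rewrite mulr_ge0// ltW.
  by rewrite /c in c0 *; lra.
have [C BC] := BCP_bound_dil d_homogeneous d_BCP.
suff : (C.+1 <= C)%N by rewrite ltnn.
apply: (BC C.+1 (fun=> (t *: v, z))) => // _ _ _.
have gap : 0 < t - t0 by rewrite subr_gt0.
have t_gt0 : 0 < t by exact: le_lt_trans t00 lt_t0t.
(* Maximality would force [c * t <= l * z]; using [z + 1] keeps the threshold for [l] defined when
   [z = 0]. *)
have z1 : 0 < z + 1 by rewrite ltr_wpDl.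
have ctz : 0 < c * t / (z + 1) by rewrite divr_gt0// mulr_gt0.
near=> l; rewrite ltNge dist_dil_self; apply/negP => /=.
have l0 : 0 < l by near: l; exact: nbhs_right_gt.
have l1 : l < 1 by near: l; exact: nbhs_right_lt.
rewrite scalerA => /tzmax; have -> : t0 <= (1 - l) * t <= 1.
  have : l < t - t0 by near: l; exact: nbhs_right_lt.
  have : l * t <= l by rewrite ler_piMr// ltW.
  have : 0 <= l * t by rewrite mulr_ge0// ltW.
  by move=> *; apply/andP; split; lra.
have l21 : l ^+ 2 <= 1 by rewrite expr_le1// ltW.
rewrite mulr_ge0 ?subr_ge0// => /(_ erefl erefl); apply/negP; rewrite -ltNge.
have lz : l < c * t / (z + 1) by near: l; exact: nbhs_right_lt.
have : l * (l * (z + 1)) < l * (c * t).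
  by rewrite ltr_pM2l// -ltr_pdivlMr.
have : 0 < l * l by rewrite mulr_gt0.
nra.
Unshelve. all: by end_near. Qed.

Lemma profile_max v : shadow d v -> phi v <= phi 0.
Proof.
by move=> Kv; rewrite -[0](scale0r v); apply: profile_ray; rewrite // lexx ler01.
Qed.

End BCP.
End Profile.

(** * Euclidean plane *)

Section Plane.
Context {R : realType}.
Implicit Types v w u c g e : 'rV[R]_2.

Lemma dotE v w : dot v w = v 0 0 * w 0 0 + v 0 1 * w 0 1.
Proof.
rewrite /dot !big_ord_recl big_ord0 addr0.
by congr (_ + v _ _ * w _ _); apply: val_inj.
Qed.

Lemma dotC v w : dot v w = dot w v.
Proof. by rewrite !dotE; ring. Qed.

Lemma dotNr v w : dot v (- w) = - dot v w.
Proof. by rewrite !dotE !mxE; ring. Qed.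

(** The Cauchy-Binet identity in the plane; for [w = v] it expands [g] along [v] and its
    orthogonal. *)
Lemma dot_omega v w g u :
  dot v w * dot g u = dot g v * dot w u + omega w g * omega v u.
Proof. by rewrite !dotE /omega; ring. Qed.

Lemma dotvv_ge0 v : 0 <= dot v v.
Proof. by rewrite dotE addr_ge0// -expr2 sqr_ge0. Qed.

Lemma dotvv_eq0 v : dot v v = 0 -> v = 0.
Proof.
move=> /eqP; rewrite dotE paddr_eq0 -?expr2 ?sqr_ge0// !sqrf_eq0.
move=> /andP[/eqP v0 /eqP v1]; rewrite (row2E v) v0 v1.
by rewrite !scale0r addr0.
Qed.

Lemma enorm_ge0 v : 0 <= enorm v. Proof. exact: sqrtr_ge0. Qed.

Lemma sqr_enorm v : enorm v ^+ 2 = dot v v.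
Proof. by rewrite sqr_sqrtr// dotvv_ge0. Qed.

Lemma enorm_gt0 v : v != 0 -> 0 < enorm v.
Proof.
move=> v0; rewrite lt_neqAle enorm_ge0 andbT eq_sym; apply: contra_neq v0.
by move=> nv0; apply: dotvv_eq0; rewrite -sqr_enorm nv0 expr0n.
Qed.

Lemma enorm_dir v : v != 0 -> enorm v *: ((enorm v)^-1 *: v) = v.
Proof.
by move=> v0; rewrite scalerA divff ?scale1r// gt_eqF// enorm_gt0.
Qed.

Lemma sqr_dot_omega v w :
  dot v w ^+ 2 + omega v w ^+ 2 = (enorm v * enorm w) ^+ 2.
Proof. by rewrite exprMn !sqr_enorm !dotE /omega; ring. Qed.

Lemma ler_dot_enorm v w : `|dot v w| <= enorm v * enorm w.
Proof.
rewrite -ler_sqr ?nnegrE ?mulr_ge0 ?enorm_ge0// real_normK ?num_real//.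
by rewrite -sqr_dot_omega lerDl sqr_ge0.
Qed.

Lemma angle_cos v w (x : R) : v != 0 -> w != 0 -> x <= pi -> angle v w <= x ->
  cos x * (enorm v * enorm w) <= dot v w.
Proof.
move=> v0 w0 xpi; rewrite /angle.
have n0 : 0 < enorm v * enorm w by rewrite mulr_gt0 ?enorm_gt0.
set y := _ / _ => yx; rewrite -ler_pdivlMr// -/y.
have y1 : -1 <= y <= 1.
  rewrite -ler_norml /y normrM normfV (gtr0_norm n0) ler_pdivrMr// mul1r.
  exact: ler_dot_enorm.
have ay0 : 0 <= acos y by exact: acos_ge0.
have ayI : acos y \in `[0, pi] by rewrite in_itv/= ay0 acos_lepi.
have xI : x \in `[0, pi] by rewrite in_itv/= xpi (le_trans ay0).
by rewrite -[leRHS]acosK ?in_itv//= leNgt ltr_cos// -leNgt.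
Qed.

Lemma omega_sin v w (x : R) : 0 <= x <= pi -> 0 <= cos x ->
  cos x * (enorm v * enorm w) <= dot v w ->
  `|omega v w| <= sin x * (enorm v * enorm w).
Proof.
move=> x0 cx0 h.
have n0 : 0 <= enorm v * enorm w by rewrite mulr_ge0 ?enorm_ge0.
have s0 : 0 <= sin x * (enorm v * enorm w) by rewrite mulr_ge0// sin_ge0_pi.
rewrite -ler_sqr ?nnegrE//.
rewrite real_normK ?num_real// exprMn sin2cos2.
have := sqr_dot_omega v w.
have : (cos x * (enorm v * enorm w)) ^+ 2 <= dot v w ^+ 2.
  have a0 : 0 <= cos x * (enorm v * enorm w) by rewrite mulr_ge0.
  by rewrite ler_sqr ?nnegrE// (le_trans a0 h).
rewrite exprMn; lra.
Qed.

Lemma derive_gradient (f : 'rV[R]_2 -> R) v w :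
  differentiable f v -> 'D_w f v = dot (gradient f v) w.
Proof.
move=> df; rewrite dotE !mxE !deriveE// {1}(row2E w) linearD !linearZ/=.
by rewrite ![_ * w _ _]mulrC.
Qed.

(** Parallel unit vectors are equal or opposite, and a common open half-plane excludes the latter.
    This gives strictness when directions are ordered by angle. *)
Lemma unit_circle_eq c e e' : enorm e = 1 -> enorm e' = 1 ->
  0 < dot c e -> 0 < dot c e' -> omega e e' = 0 -> e = e'.
Proof.
move=> e1 e'1 ce ce' ee'0.
have := sqr_dot_omega e e'; rewrite ee'0 e1 e'1 mulr1 expr1n expr0n addr0.
move=> /eqP; rewrite sqrf_eq1 => /orP[]/eqP ee'.
- apply/subr0_eq/dotvv_eq0.
  have -> : dot (e - e') (e - e') = dot e e + dot e' e' - 2 * dot e e'.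
    by rewrite !dotE !mxE; ring.
  by rewrite -!sqr_enorm e1 e'1 ee'; ring.
- have E : e = - e'.
    apply/subr0_eq/dotvv_eq0; rewrite opprK.
    have -> : dot (e + e') (e + e') = dot e e + dot e' e' + 2 * dot e e'.
      by rewrite !dotE !mxE; ring.
    by rewrite -!sqr_enorm e1 e'1 ee'; ring.
  by move: ce; rewrite E dotNr oppr_gt0 ltNge ltW.
Qed.

Lemma near_omega (s : R) e e' : 0 < s * omega e e' ->
  \forall k \near 0^'+, forall x y, ball e k x -> ball e' k y ->
    k <= s * omega x y.
Proof.
move=> h.
have c : (fun z : 'rV[R]_2 * 'rV[R]_2 => s * omega z.1 z.2) @ (e, e') -->
    s * omega e e'.
  by apply: cvgMr; apply: cvg_omega; [exact: cvg_fst|exact: cvg_snd].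
have h2 : s * omega e e' / 2 < s * omega e e' by lra.
have h3 : 0 < s * omega e e' / 2 by lra.
have : \forall z \near (e, e'), s * omega e e' / 2 < s * omega z.1 z.2.
  exact: (@cvgr_gt R _ _ _ _ _ c _ h2).
move=> /nbhs_ballP[r /= r0 hr].
near=> k => x y xk yk; apply: (@le_trans _ _ (s * omega e e' / 2)).
  by near: k; exact: nbhs_right_ltW.
apply/ltW/(hr (x, y)); have kr : k <= r by near: k; exact: nbhs_right_ltW.
by split; [exact: le_ball kr _ xk|exact: le_ball kr _ yk].
Unshelve. all: by end_near. Qed.

(* [g = grad phi v]; expanding along [v] and its orthogonal, the functional
   [u |-> g.u + s omega(v,u)/2] has a nonpositive [v]-coefficient, and it is the
   transverse coefficient, of the sign of [s], that dominates. *)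
Lemma transverse_domination (s eta cx sx kappa : R) v w g :
  v != 0 -> w != 0 -> dot g v <= 0 -> 0 <= s * omega v g -> s * s = 1 ->
  0 < kappa -> 4 * eta <= kappa -> 1 / 2 <= cx -> 2 * sx <= kappa ->
  cx * (enorm v * enorm w) <= dot v w ->
  `|omega v w| <= sx * (enorm v * enorm w) ->
  - eta * enorm v * enorm w < dot g w ->
  forall u, u != 0 -> kappa * enorm v * enorm u <= s * omega v u ->
    0 < dot g u + s * omega v u / 2.
Proof.
move=> v0 w0 gv sB ss k0 etak cxk sxk vw ovw gw u u0 ku.
set V := enorm v; have V0 : 0 < V by exact: enorm_gt0.
set W := enorm w; have W0 : 0 < W by exact: enorm_gt0.
set U := enorm u; have U0 : 0 < U by exact: enorm_gt0.
rewrite -/V -/W -/U in vw ovw gw ku.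
have VE : V ^+ 2 = dot v v by exact: sqr_enorm.
set A := - dot g v; have A0 : 0 <= A by rewrite oppr_ge0.
set B := s * omega v g; rewrite -/B in sB.
have Bomega u' : omega v g * omega v u' = B * (s * omega v u').
  by rewrite /B mulrACA [_ * s]mulrC mulrA ss mul1r.
(* Expanding [dot g w] along [v] and its orthogonal, with [cx >= 1 / 2], the failure of the slope
   bound at [w] controls the radial part [A] by the transverse part [B], up to an [eta] term. *)
have hA : A < 2 * (eta * V ^+ 2 + B * sx).
  have := dot_omega v v g w; rewrite -VE Bomega => E.
  have e1 : - eta * V * W * V ^+ 2 < V ^+ 2 * dot g w.
    by rewrite mulrC ltr_pM2l// exprn_gt0.
  have e2 : A * (cx * (V * W)) <= A * dot v w by exact: ler_wpM2l.
  have e3 : B * (s * omega v w) <= B * (sx * (V * W)).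
    apply: ler_wpM2l => //; apply: le_trans ovw.
    apply: le_trans (ler_norm _) _; rewrite normrM.
    have -> : `|s| = 1.
      by apply/eqP; rewrite -sqrp_eq1// real_normK ?num_real// expr2 ss.
    by rewrite mul1r.
  have e4 : A * (1 / 2 * (V * W)) <= A * (cx * (V * W)).
    by apply: ler_wpM2l => //; apply: ler_wpM2r => //; rewrite ltW// mulr_gt0.
  have VW0 : 0 < V * W by rewrite mulr_gt0.
  rewrite -(ltr_pM2r VW0).
  have E' : V ^+ 2 * dot g w = - (A * dot v w) + B * (s * omega v w).
    by rewrite E /A; ring.
  rewrite E' in e1.
  have -> : 2 * (eta * V ^+ 2 + B * sx) * (V * W) =
    2 * (eta * V * W * V ^+ 2) + 2 * (B * (sx * (V * W))) by ring.
  have -> : A * (V * W) = 2 * (A * (1 / 2 * (V * W))) by field.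
  lra.
(* The term [V ^+ 2 / 2] matches [s * omega v u / 2] after multiplication by [V ^+ 2]; it absorbs
   the [eta] term. *)
have hB : A < kappa * (B + V ^+ 2 / 2).
  apply: lt_le_trans hA _.
  have : 4 * eta * V ^+ 2 <= kappa * V ^+ 2.
    by apply: ler_wpM2r => //; rewrite exprn_ge0// ltW.
  have : B * (2 * sx) <= B * kappa by apply: ler_wpM2l.
  lra.
rewrite -(@pmulr_rgt0 _ (V ^+ 2)) ?exprn_gt0// mulrDr.
have -> : V ^+ 2 * dot g u = - (A * dot v u) + B * (s * omega v u).
  by rewrite VE dot_omega Bomega /A; ring.
have e5 : A * dot v u <= A * (V * U).
  by apply: ler_wpM2l => //; apply: le_trans (ler_norm _) (ler_dot_enorm _ _).
have e6 : A * (V * U) < kappa * (B + V ^+ 2 / 2) * (V * U).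
  by rewrite ltr_pM2r// mulr_gt0.
have e7 : (B + V ^+ 2 / 2) * (kappa * V * U) <= (B + V ^+ 2 / 2) * (s * omega v u).
  by apply: ler_wpM2l => //; rewrite addr_ge0// divr_ge0// exprn_ge0// ltW.
have -> : V ^+ 2 * (s * omega v u / 2) = V ^+ 2 / 2 * (s * omega v u) by field.
lra.
Qed.

End Plane.

(** * Exceptional directions *)

Section Slopes.
Context {R : realType} (d : Heis R -> Heis R -> R) (phi : 'rV[R]_2 -> R).
Hypothesis d_homogeneous : homogeneous_distance d.
Hypothesis phi_profile : is_profile d phi.
Hypothesis d_BCP : BCP d.
Implicit Types (p q : Heis R) (v w u c e : 'rV[R]_2) (s : R).

(** For [s = -1] this is invariance under inversion; it treats top and bottom of the ball
    together. *)
Lemma heis_norm_sign s p : s * s = 1 ->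
  heis_norm d (s *: p.1, s * p.2) = heis_norm d p.
Proof.
case: p => v z /=; rewrite -expr2 => /eqP; rewrite sqrf_eq1 => /orP[]/eqP ->.
  by rewrite scale1r mul1r.
by rewrite scaleN1r mulN1r -(heis_normV d_homogeneous (v, z)).
Qed.

Lemma dist_dil_sign s l v w y z : s * s = 1 ->
  d (s *: v, s * z) (heis_dil l (s *: w, s * y)) =
  heis_norm d (v - l *: w, z - l ^+ 2 * y + l * (s * omega v w / 2)).
Proof.
move=> ss; have dC p q : d p q = d q p by case: d_homogeneous => -[].
rewrite dC dist_norm// -[RHS](heis_norm_sign _ ss); congr (heis_norm d (_, _)) => /=.
  by rewrite scalerBr addrC !scalerA mulrC.
rewrite !omegaE; have -> : omega w v = - omega v w by rewrite /omega; ring.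
by field.
Qed.

(** To first order in [l], up to symmetry, the relative position has height
    [phi v + l * s * omega v w / 2] over [v - l *: w], where the profile is
    [phi v - l * dot (gradient phi v) w]. *)
Lemma near_dist_gt1 s v w : s * s = 1 -> differentiable phi v ->
  0 < dot (gradient phi v) w + s * omega v w / 2 ->
  \forall l \near 0^'+,
    1 < d (s *: v, s * phi v) (heis_dil l (s *: w, s * phi w)).
Proof.
move=> ss dphi h.
have dv : derivable phi v (- w) by exact: diff_derivable.
(* The summand [l * phi w] is the height [l ^+ 2 * phi w] of the dilated point, divided by [l]. *)
have c1 : (fun l : R => l^-1 *: (phi (l *: - w + v) - phi v) + l * phi w)
    @ 0^'+ --> - dot (gradient phi v) w + 0 * phi w.
  apply: cvgD.
    rewrite -dotNr -derive_gradient//; exact: cvg_dnbhs_at_right dv.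
  by apply: cvgMl; apply: cvg_at_right_filter; exact: cvg_id.
have h' : - dot (gradient phi v) w + 0 * phi w < s * omega v w / 2 by lra.
have hn := @cvgr_lt R _ _ _ _ _ c1 _ h'.
near=> l; rewrite dist_dil_sign// ltNge; apply/negP => /(le_profile phi_profile) /=.
have l0 : 0 < l by near: l; exact: nbhs_right_gt.
apply/negP; rewrite -ltNge.
have : l^-1 *: (phi (l *: - w + v) - phi v) + l * phi w < s * omega v w / 2.
  by near: l; exact: hn.
rewrite -(ltr_pM2l l0) mulrDr scalerN addrC [- _ + v]addrC.
have -> : l * (l^-1 *: (phi (v - l *: w) - phi v)) = phi (v - l *: w) - phi v.
  by rewrite /GRing.scale/= mulrA divff ?gt_eqF// mul1r.
by move=> ?; lra.
Unshelve. all: by end_near. Qed.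

(** Otherwise, as [omega v v = 0], the constant sequence at the top point over [v] would give chains
    of any length. *)
Lemma dot_gradient_le0 v : shadow d v -> differentiable phi v ->
  dot (gradient phi v) v <= 0.
Proof.
move=> Kv dphi; rewrite leNgt; apply/negP => h.
have [C BC] := BCP_bound_dil d_homogeneous d_BCP.
suff : (C.+1 <= C)%N by rewrite ltnn.
apply: (BC C.+1 (fun=> (1 *: v, 1 * phi v))) => [_ _|_ _ _].
  by rewrite scale1r mul1r profile_norm.
by apply: near_dist_gt1; rewrite ?mul1r// omegavv mul0r addr0.
Qed.

(* The condition on [u] makes the top point of the unit ball over [v] (the bottom
   point over [-v] when [s = -1]) lie at distance more than 1 from small dilations
   of the corresponding point over [s u], see [near_dist_gt1]. *)
Definition transverse s v (kappa : R) := forall u, u != 0 ->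
  kappa * enorm v * enorm u <= s * omega v u ->
  0 < dot (gradient phi v) u + s * omega v u / 2.

(** Candidate exceptional directions: with [kappa] small, the functional is positive on almost the
    whole half-plane on the side [s] of [v]. *)
Definition transverse_dirs s : set 'rV[R]_2 := [set e | enorm e = 1 /\
  forall (kappa : R) (U : set 'rV[R]_2), 0 < kappa -> nbhs e U -> exists v,
  [/\ shadow d v, v != 0, differentiable phi v, U ((enorm v)^-1 *: v) &
      transverse s v kappa]].

(** Each direction is on the side [s] of the earlier ones, so points chosen over nearby directions
    meet the condition of [BCP_bound_dil]. *)
Lemma transverse_chain s : s * s = 1 -> exists C : nat, forall n (e : nat -> 'rV[R]_2),
  (forall i, (i < n)%N -> transverse_dirs s (e i)) ->
  (forall i j, (i < j < n)%N -> 0 < s * omega (e i) (e j)) -> (n <= C)%N.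
Proof.
move=> ss; have [C BC] := BCP_bound_dil d_homogeneous d_BCP.
exists C => n e eT eo.
(* One [k] for all pairs: both the radius around the directions and the transversality parameter. *)
have [k [k0 hk]] : exists k : R, 0 < k /\ forall i j, (i < j < n)%N ->
    forall x y, ball (e i) k x -> ball (e j) k y -> k <= s * omega x y.
  have hn : \forall k \near (0 : R)^'+, forall i j, (i < j < n)%N ->
      forall x y, ball (e i) k x -> ball (e j) k y -> k <= s * omega x y.
    by apply: near_forall_ltn2 => i j ij; apply: near_omega; exact: eo.
  near (0 : R)^'+ => k; exists k; split; near: k; last exact: hn.
  exact: nbhs_right_gt.
have /choice[v vP] : forall i, exists v, (i < n)%N ->
    [/\ shadow d v, v != 0, differentiable phi v,
        ball (e i) k ((enorm v)^-1 *: v) & transverse s v k].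
  move=> i; case: (ltnP i n) => ni; last by exists 0.
  have [v vP] := (eT _ ni).2 k _ k0 (nbhsx_ballx (e i) k k0).
  by exists v.
apply: (BC n (fun i => (s *: v i, s * phi (v i)))).
  move=> i /vP[Kv _ _ _ _].
  by rewrite (heis_norm_sign (v i, phi (v i)) ss) profile_norm.
move=> i j /[dup] ijn /andP[ij jn].
have [_ v0 dv vi Tv] := vP i (ltn_trans ij jn).
have [_ w0 _ vj _] := vP j jn.
apply: near_dist_gt1 => //; apply: Tv => //.
rewrite -{2}(enorm_dir v0) -{2}(enorm_dir w0) omegaZl omegaZr.
have := hk _ _ ijn _ _ vi vj; set o := omega _ _ => ho.
have -> : s * (enorm (v i) * (enorm (v j) * o)) =
  enorm (v i) * enorm (v j) * (s * o) by ring.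
by rewrite -mulrA mulrC ler_wpM2l// mulr_ge0// enorm_ge0.
Unshelve. all: by end_near. Qed.

(** Within an open half-plane, sorting by angle turns any finite set of directions into a chain. *)
Lemma finite_transverse_half s c : s * s = 1 ->
  finite_set (transverse_dirs s `&` [set e | 0 < dot c e]).
Proof.
move=> ss; have [C chain] := transverse_chain ss.
apply: contrapT => /(infinite_set_fset C.+1)[B BA sB].
(* [s] times the tangent of the oriented angle from [c] to [e]. *)
pose key e := s * omega c e / dot c e.
pose l := sort (fun x y => key x <= key y) (finmap.enum_fset B).
have lB e : e \in l -> transverse_dirs s e /\ 0 < dot c e.
  by rewrite mem_sort => eB; apply: BA.
have ul : uniq l by rewrite sort_uniq; exact: finmap.fset_uniq.
have sl : sorted (fun x y => key x <= key y) l.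
  by apply: sort_sorted => x y; exact: le_total.
have zl : (C.+1 <= size l)%N by rewrite size_sort.
suff : (C.+1 <= C)%N by rewrite ltnn.
apply: (chain _ (fun i => nth 0 l i)) => [i iC|i j /andP[ij jC]].
  by apply: (lB _ _).1; apply: mem_nth; exact: leq_trans zl.
have jl : (j < size l)%N by exact: leq_trans zl.
have il : (i < size l)%N by exact: ltn_trans jl.
have [[ei1 _] ci] := lB _ (mem_nth 0 il).
have [[ej1 _] cj] := lB _ (mem_nth 0 jl).
have kij : key (nth 0 l i) <= key (nth 0 l j).
  apply: (sorted_leq_nth _ _ _ sl); rewrite ?inE//; last exact: ltnW.
  by move=> y x z; exact: le_trans.
have nij : nth 0 l i != nth 0 l j by rewrite nth_uniq// ltn_eqF.
set x := nth 0 l i in ei1 ci kij nij *; set y := nth 0 l j in ej1 cj kij nij *.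
have c0 : 0 < dot c c.
  rewrite lt_neqAle dotvv_ge0 andbT eq_sym; apply/eqP => /dotvv_eq0 c0.
  by move: ci; rewrite c0 dotE !mxE !mul0r addr0 ltxx.
(* Up to positive factors, [s * omega x y] is the difference of the keys. *)
have E : dot c c * (s * omega x y) = dot c x * dot c y * (key y - key x).
  have kx : key x * dot c x = s * omega c x by rewrite divfK// gt_eqF.
  have ky : key y * dot c y = s * omega c y by rewrite divfK// gt_eqF.
  transitivity (dot c x * (key y * dot c y) - dot c y * (key x * dot c x)).
    by rewrite kx ky !dotE /omega; ring.
  by ring.
rewrite -(@pmulr_rgt0 _ (dot c c))// lt_neqAle; apply/andP; split; last first.
  by rewrite E mulr_ge0 ?subr_ge0// mulr_ge0// ltW.
apply/negP; rewrite eq_sym mulf_eq0 gt_eqF//= mulf_eq0 => /orP[/eqP s0|/eqP o0].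
  by move: ss; rewrite s0 mul0r => /esym/eqP; rewrite oner_eq0.
by move: nij; rewrite (unit_circle_eq ei1 ej1 ci cj o0) eqxx.
Qed.

(** Four open half-planes cover the circle. *)
Lemma finite_transverse s : s * s = 1 -> finite_set (transverse_dirs s).
Proof.
move=> ss; pose H c := transverse_dirs s `&` [set e | 0 < dot c e].
have fH c : finite_set (H c) by exact: finite_transverse_half.
apply: (@sub_finite_set _ _ ((H (delta_mx 0 0) `|` H (- delta_mx 0 0)) `|`
  (H (delta_mx 0 1) `|` H (- delta_mx 0 1)))); last first.
  by rewrite !finite_setU.
move=> e eT.
have D0 : dot (delta_mx 0 0) e = e 0 0 by rewrite dotE !mxE /=; ring.
have D1 : dot (delta_mx 0 1) e = e 0 1 by rewrite dotE !mxE /=; ring.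
have DN c : dot (- c) e = - dot c e by rewrite dotC dotNr dotC.
case: (ltrgtP (e 0 0) 0) => e0.
- by left; right; split=> //=; rewrite DN D0 oppr_gt0.
- by left; left; split=> //=; rewrite D0.
- case: (ltrgtP (e 0 1) 0) => e1.
  + by right; right; split=> //=; rewrite DN D1 oppr_gt0.
  + by right; left; split=> //=; rewrite D1.
  + have := eT.1; rewrite /enorm dotE e0 e1 !mul0r addr0 sqrtr0 => /esym/eqP.
    by rewrite oner_eq0.
Qed.

(** [harmonic n], that is [1 / (n + 1)], is both slope and aperture, so a countable family of
    conditions suffices. *)
Definition steep (n : nat) v := forall w, w != 0 -> angle v w <= harmonic n ->
  dot (gradient phi v) w <= - harmonic n * enorm v * enorm w.

(** Taken as a union of open sets so as to be open by construction. *)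
Definition steep_region (n : nat) : set 'rV[R]_2 :=
  \bigcup_(U in [set U | open U /\ forall v, (shadow d)° v -> v != 0 ->
     differentiable phi v -> U ((enorm v)^-1 *: v) -> steep n v]) U.

(** The smallness conditions of [transverse_domination]. *)
Lemma near_harmonic_small (kappa : R) : 0 < kappa ->
  \forall n \near \oo, [/\ 4 * @harmonic R n <= kappa, 1 / 2 <= cos (@harmonic R n)
    & 2 * sin (@harmonic R n) <= kappa].
Proof.
move=> k0.
have c0 : @harmonic R n @[n --> \oo] --> (0 : R) by exact: cvg_harmonic.
have cc : cos (@harmonic R n) @[n --> \oo] --> (1 : R).
  by rewrite -cos0; apply: continuous_cvg c0; exact: continuous_cos.
have cs : sin (@harmonic R n) @[n --> \oo] --> (0 : R).
  by rewrite -sin0; apply: continuous_cvg c0; exact: continuous_sin.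
near=> n; split.
- have : @harmonic R n < kappa / 4.
    by near: n; apply: (@cvgr_lt R _ _ _ _ _ c0); rewrite divr_gt0.
  by lra.
- by apply/ltW; near: n; apply: (@cvgr_gt R _ _ _ _ _ cc); lra.
- have : sin (@harmonic R n) < kappa / 2.
    by near: n; apply: (@cvgr_lt R _ _ _ _ _ cs); rewrite divr_gt0.
  by lra.
Unshelve. all: by end_near. Qed.

Lemma harmonic_le1 n : @harmonic R n <= 1.
Proof. by rewrite /harmonic invf_le1// ler1n. Qed.

(** If [e] is transverse for neither sign, some neighbourhood excludes transverse points of both
    signs. A failure of steepness there would produce one, by [transverse_domination], with [s]
    given by the sign of [omega v (gradient phi v)]. *)
Lemma steep_or_transverse e : enorm e = 1 ->
  (forall n, ~ steep_region n.+1 e) -> transverse_dirs 1 e \/ transverse_dirs (-1) e.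
Proof.
move=> e1 eW; apply: contrapT => /not_orP[n1 n2].
have nT s : ~ transverse_dirs s e -> exists kappa : R, exists U : set 'rV[R]_2,
    [/\ 0 < kappa, nbhs e U & forall v, shadow d v -> v != 0 ->
      differentiable phi v -> U ((enorm v)^-1 *: v) -> ~ transverse s v kappa].
  move=> ns; apply: contrapT => h; apply: ns; split => // kappa U k0 Ue.
  apply: contrapT => h'; apply: h; exists kappa, U; split => // v Kv v0 dv Uv Tv.
  by apply: h'; exists v.
have [k1 [U1 [k10 U1e T1]]] := nT _ n1.
have [k2 [U2 [k20 U2e T2]]] := nT _ n2.
have k0 : 0 < Num.min k1 k2 by rewrite lt_min k10.
have [[|n] [[eta4 cosn sinn] // _]] := filter_ex
  (filterI (near_harmonic_small k0) (nbhs_infty_gt 0)).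
apply: (eW n); exists (U1 `&` U2)°; last first.
  exact: filterI.
split; first exact: open_interior.
move=> v Kv' v0 dv /interior_subset[U1v U2v] w w0 vw.
have Kv : shadow d v by exact: interior_subset.
rewrite leNgt; apply/negP => steepv.
have hpi : @harmonic R n.+1 <= pi.
  by apply: le_trans (harmonic_le1 n.+1) _; apply: le_trans (@pi_ge2 R); rewrite ler1n.
have h0 : 0 <= @harmonic R n.+1 by rewrite /harmonic invr_ge0.
have cvw := angle_cos v0 w0 hpi vw.
have cos_ge0 : 0 <= cos (@harmonic R n.+1) by apply: le_trans cosn; rewrite divr_ge0.
have svw := omega_sin (introT andP (conj h0 hpi)) cos_ge0 cvw.
have gv := dot_gradient_le0 Kv dv.
have T s : s * s = 1 -> 0 <= s * omega v (gradient phi v) ->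
    transverse s v (Num.min k1 k2).
  move=> ss sB u u0.
  exact: (transverse_domination v0 w0 gv sB ss k0 eta4 cosn sinn cvw svw steepv u0).
(* Transversality weakens as the parameter grows, so the minimum serves both signs. *)
have Tmono s (k : R) : Num.min k1 k2 <= k ->
    transverse s v (Num.min k1 k2) -> transverse s v k.
  move=> kk Ts u u0 ku; apply: Ts => //; apply: le_trans ku.
  by apply: ler_wpM2r; rewrite ?enorm_ge0//; apply: ler_wpM2r; rewrite ?enorm_ge0.
case: (lerP 0 (omega v (gradient phi v))) => B.
- apply: (T1 v Kv v0 dv U1v); apply: (Tmono _ k1); first by rewrite ge_min lexx.
  by apply: T; rewrite mul1r.
- apply: (T2 v Kv v0 dv U2v); apply: (Tmono _ k2); first by rewrite ge_min lexx orbT.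
  by apply: T; rewrite ?mulrNN ?mul1r// mulN1r oppr_ge0 ltW.
Qed.

End Slopes.

(** * The pole *)

Lemma differentiable_flat (R : realType) (V : normedModType R) (f : V -> R) (x : V) :
  (forall c : R, 0 < c -> \forall h \near (0 : V), `|f (h + x) - f x| <= c * `|h|) ->
  differentiable f x /\ 'd f x = (fun=> 0) :> (V -> R).
Proof.
move=> flat.
pose df : {linear V -> R} := \0.
have dfE : df = (fun=> 0) :> (V -> R) by [].
have fo : f \o shift x = cst (f x) + df +o_ (0 : V) id.
  apply/eqaddoP => c c0; have := flat c c0; apply: filterS => h /=.
  by rewrite !fctE dfE addr0.
have ddf : 'd f x = df :> (V -> R).
  by apply: diff_unique fo; rewrite dfE; exact: cst_continuous.
split=> //; apply/diff_locallyP; rewrite ddf; split=> //.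
by rewrite dfE; exact: cst_continuous.
Qed.

Section Pole.
Context {R : realType} (d : Heis R -> Heis R -> R) (phi : 'rV[R]_2 -> R).
Hypothesis d_homogeneous : homogeneous_distance d.
Hypothesis phi_profile : is_profile d phi.
Hypothesis d_BCP : BCP d.
Implicit Types (p q : Heis R) (v w u e : 'rV[R]_2).

Lemma profile_lipschitz0 : exists k r : R, [/\ 0 < k, 0 < r &
  forall v w, `|v| < r -> `|w| < r -> `|phi v - phi w| <= k * `|v - w|].
Proof.
case: phi_profile => _ _ lip _; have [|U U0 /pinfty_ex_gt0[k k0 kU]] := lip 0.
  exact: shadow_nbhs0.
move: U0 => /nbhs_ballP[r /= r0 rU]; exists k, r; split => // v w vr wr.
have inU u : `|u| < r -> U u.
  by move=> ur; apply: rU; rewrite -ball_normE /= sub0r normrN.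
by apply: (kU (v, w)); split; exact: inU.
Qed.

(* Otherwise compactness of the sphere and the Lipschitz bound provide a direction
   in which the profile has an outgoing corner. *)
Lemma corner_direction (c : R) : 0 < c ->
  ~ (\forall v \near (0 : 'rV[R]_2), phi 0 - phi v <= c * `|v|) ->
  exists e, forall rho : R, 0 < rho -> exists t : R,
    0 < t < rho /\ c / 2 * t <= phi 0 - phi (t *: e).
Proof.
move=> c0 ncone; have [k [r [k0 r0 lip]]] := profile_lipschitz0.
pose D := [set v | c * `|v| < phi 0 - phi v].
(* Points violating the cone bound accumulate at 0; [e] will be a cluster point of their
   directions. *)
have FP : ProperFilter (within D (nbhs (0 : 'rV[R]_2))).
  apply: Build_ProperFilter_ex => A; rewrite /within/= => DA.
  apply: contrapT => noA; apply: ncone; near=> v.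
  rewrite leNgt; apply/negP => Dv; apply: noA; exists v.
  by move: Dv; near: v; exact: DA.
have Dneq0 v : D v -> v != 0.
  by apply: contraPneq => ->; rewrite /D/= normr0 mulr0 subrr ltxx.
pose S := [set e : 'rV[R]_2 | `|e| = 1].
have cS : compact S.
  apply: bounded_closed_compact.
    exists 1; split; first exact: num_real.
    by move=> M M1 e /= ->; exact: ltW.
  apply: (@preimage_closed _ _ (fun e : 'rV[R]_2 => `|e|) [set y | y = 1]).
    by move=> x _; exact: norm_continuous.
  exact: closed_eq.
pose dir v := `|v|^-1 *: v.
have FS : (dir @ within D (nbhs (0 : 'rV[R]_2))) S.
  rewrite /fmap/= /within/=; apply: nearW => v /Dneq0 v0.
  by rewrite /S/= normrZ normfV normr_id mulVf// normr_eq0.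
have [e [e1 ecl]] := cS _ (fmap_proper_filter dir FP) FS.
exists e => rho rho0.
have m0 : 0 < Num.min rho r by rewrite lt_min rho0.
(* With this radius, replacing [v] by the multiple of [e] of the same norm costs at most half of the
   slope [c]. *)
have ck0 : 0 < c / (2 * k) by rewrite divr_gt0// mulr_gt0.
have [|_ [[v [Dv vm] <-] ev]] := ecl (dir @` (D `&` ball 0 (Num.min rho r)))
    (ball e (c / (2 * k))) _ (nbhsx_ballx _ _ ck0).
  have : \forall v \near (0 : 'rV[R]_2), ball 0 (Num.min rho r) v.
    exact: nbhsx_ballx.
  by apply: filterS => v vm Dv; exists v.
have vmn : `|v| < Num.min rho r by move: vm; rewrite -ball_normE /= sub0r normrN.
have v0 : 0 < `|v| by rewrite normr_gt0 Dneq0.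
have [vrho vr] : `|v| < rho /\ `|v| < r by move: vmn; rewrite lt_min => /andP[].
exists `|v|; rewrite v0 vrho; split => //.
have ter : `| `|v| *: e | < r by rewrite normrZ normr_id e1 mulr1.
have := lip _ _ ter vr.
have -> : `|v| *: e - v = `|v| *: (e - dir v).
  by rewrite scalerBr /dir scalerA divff ?scale1r// gt_eqF.
rewrite normrZ normr_id => h.
have : k * (`|v| * `|e - dir v|) <= k * (`|v| * (c / (2 * k))).
  do 2 (apply: ler_wpM2l; first exact: ltW); apply: ltW.
  by move: ev; rewrite -ball_normE.
have -> : k * (`|v| * (c / (2 * k))) = c / 2 * `|v| by field; rewrite gt_eqF.
move=> h2; have := le_trans h h2; rewrite ler_norml => /andP[_ h3].
move: Dv; rewrite /D/= => h4; lra.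
Unshelve. all: by end_near. Qed.

Lemma profile_continuous0 : phi v @[v --> (0 : 'rV[R]_2)] --> phi 0.
Proof.
have [k [r [k0 r0 lip]]] := profile_lipschitz0.
have small (x : R) : 0 < x -> \forall v \near (0 : 'rV[R]_2), `|v| < x.
  by move=> x0; exact: nbhs0_lt.
apply/(@cvgrPdist_lt _ _ _ (nbhs (0 : 'rV[R]_2))) => eps eps0.
apply: filterS2 (small _ r0) (small _ (divr_gt0 eps0 k0)) => v vr veps.
apply: le_lt_trans (lip 0 v _ vr) _; rewrite ?normr0//.
by rewrite sub0r normrN mulrC -ltr_pdivlMr.
Qed.

(** * Large Besicovitch families from a corner at the pole *)

Section Corner.
Variables (e : 'rV[R]_2) (c : R).
Hypothesis c_gt0 : 0 < c.
Hypothesis corner : forall rho : R, 0 < rho -> exists t : R,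
  0 < t < rho /\ c * t <= phi 0 - phi (t *: e).

Let dC p q : d p q = d q p.
Proof. by case: d_homogeneous => -[]. Qed.

(** Rescaled by [t / x], the relative position lies over a point of the ray of [e] at or beyond
    [t *: e]. By [profile_ray] and the corner the profile there is at most [phi 0 - c * t], below
    the height of the point. *)
Lemma dist_pole_gt (t x y h H : R) : 0 < t -> 0 < x -> x <= y -> h <= H ->
  0 < H -> t < c * x ^+ 2 / H -> c * t <= phi 0 - phi (t *: e) ->
  x / t < d (- y *: e, h) (heis_dil (x / t) (0, phi 0)).
Proof.
move=> t0 x0 xy hH H0 tH ct.
have R0 : 0 < x / t by rewrite divr_gt0.
have -> : d (- y *: e, h) (heis_dil (x / t) (0, phi 0)) =
    x / t * heis_norm d ((y * t / x) *: e, phi 0 - h * t ^+ 2 / x ^+ 2).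
  rewrite dist_norm// -heis_norm_dil//; congr (heis_norm d (_, _)) => /=.
    rewrite scaler0 addr0 scaleNr opprK scalerA; congr (_ *: _).
    by field; rewrite !gt_eqF.
  by rewrite scaler0 omegav0; field; rewrite !gt_eqF.
rewrite -[ltLHS]mulr1 ltr_pM2l// ltNge; apply/negP => n1.
have := le_profile phi_profile n1; apply/negP; rewrite -ltNge /=.
have y0 : 0 < y by exact: lt_le_trans xy.
have t01 : 0 <= x / y <= 1 by rewrite divr_ge0 ?(ltW x0) ?(ltW y0)//= ler_pdivrMr// mul1r.
have := profile_ray d_homogeneous phi_profile d_BCP (shadow_of_norm n1) t01.
rewrite /= scalerA.
have -> : x / y * (y * t / x) = t by field; rewrite !gt_eqF.
have : h * t ^+ 2 / x ^+ 2 < c * t.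
  rewrite ltr_pdivrMr ?exprn_gt0//.
  apply: (@le_lt_trans _ _ (H * t ^+ 2)).
    by rewrite ler_wpM2r// exprn_ge0// ltW.
  move: tH; rewrite ltr_pdivlMr// => tH.
  have -> : H * t ^+ 2 = t * (t * H) by ring.
  have -> : c * t * x ^+ 2 = t * (c * x ^+ 2) by ring.
  by rewrite ltr_pM2l.
by move=> *; lra.
Qed.

(** A small enough tilt of the pole preserves strict inequalities between distances. *)
Lemma cvg_pole (r : R) p :
  d p (heis_dil r (- y *: e, phi (- y *: e))) @[y --> 0^'+] -->
  d p (heis_dil r (0, phi 0)).
Proof.
rewrite dist_norm//; under eq_fun do rewrite dist_norm//.
apply: (@continuous_cvg _ _ _ _ _ _ (heis_norm d)).
  exact: heis_norm_continuous.
apply: cvg_heis_mul; first exact: cvg_cst.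
apply: cvg_heis_dil.
have c1 : - y *: e @[y --> 0^'+] --> (0 : 'rV[R]_2).
  rewrite -(scale0r e) -{2}oppr0; apply: cvgZl; apply: cvgN.
  by apply: cvg_at_right_filter; exact: cvg_id.
apply: (cvg_pair (G := nbhs (0 : 'rV[R]_2)) (H := nbhs (phi 0))) => //.
exact: (cvg_comp _ _ c1 profile_continuous0).
Qed.

(* Each new point is a large dilation of the pole, slightly tilted towards [- e] so
   that the next, even larger, ball still avoids it. *)
Lemma corner_chain n : exists (p : nat -> Heis R) (r : nat -> R) (x H : R),
  [/\ 0 < x, 0 < H,
    forall i, (i < n)%N -> [/\ 0 < r i <= H, heis_norm d (p i) <= r i,
      (p i).2 <= H & exists2 y, x <= y & (p i).1 = - y *: e] &
    forall i j, (i < j < n)%N -> Num.max (r i) (r j) < d (p i) (p j)].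
Proof.
elim: n => [|n [p [r [x [H [x0 H0 pP pd]]]]]].
  by exists (fun=> (0, 0)), (fun=> 1), 1, 1; split => // i j; rewrite andbF.
(* The first bound makes the new radius [x / t] exceed [H], hence all earlier radii; the second is
   required by [dist_pole_gt]. *)
have rho0 : 0 < Num.min (x / H) (c * x ^+ 2 / H).
  by rewrite lt_min !divr_gt0// mulr_gt0// exprn_gt0.
have [t [/andP[t0]]] := corner rho0; rewrite lt_min => /andP[tx tc] ct.
pose s := x / t; have s0 : 0 < s by rewrite divr_gt0.
have Hs : H < s by rewrite /s ltr_pdivlMr// mulrC -ltr_pdivlMr.
pose q y : Heis R := heis_dil s (- y *: e, phi (- y *: e)).
(* The tilt is strict so that the new centre also lies over a negative multiple of [e], as the next
   step requires. *)
have [y [y0 Ky qy]] : exists y, [/\ 0 < y, shadow d (- y *: e) &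
    forall i, (i < n)%N -> s < d (p i) (q y)].
  have qn : \forall y \near (0 : R)^'+, forall i, (i < n)%N -> s < d (p i) (q y).
    apply: near_forall_ltn => i /pP[_ _ hH [z xz pz]].
    apply: (@cvgr_gt R _ _ _ _ _ (@cvg_pole s (p i))).
    rewrite [p i]surjective_pairing pz.
    exact: dist_pole_gt hH H0 tc ct.
  have Kn : \forall y \near (0 : R)^'+, shadow d (- y *: e).
    have c1 : - y *: e @[y --> (0:R)^'+] --> (0 : 'rV[R]_2).
      rewrite -(scale0r e) -{2}oppr0; apply: cvgZl; apply: cvgN.
      by apply: cvg_at_right_filter; exact: cvg_id.
    exact: c1 (shadow_nbhs0 d_homogeneous).
  near (0 : R)^'+ => y; exists y; split; near: y => //.
  exact: nbhs_right_gt.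
exists (fun i => if i == n then q y else p i), (fun i => if i == n then s else r i).
have M0 : 0 <= s ^+ 2 * phi 0.
  apply: mulr_ge0; first by rewrite exprn_ge0// ltW.
  exact: (profile_ge0 phi_profile (shadow0 d_homogeneous)).
(* The new centre has height at most [s ^+ 2 * phi 0] because the profile is maximal at 0. *)
exists (Num.min x (s * y)), (H + s + s ^+ 2 * phi 0); split.
- by rewrite lt_min x0 mulr_gt0.
- by apply: ltr_wpDr => //; exact: addr_gt0.
- move=> i; rewrite ltnS leq_eqVlt; case: eqVneq => [-> _|_ /= ni].
    split.
    + by rewrite s0; lra.
    + by rewrite heis_norm_dil// ler_piMr ?(ltW s0)// (profile_norm _ phi_profile).
    + rewrite /q /=; have := profile_max d_homogeneous phi_profile d_BCP Ky.
      move=> /(ler_wpM2l (exprn_ge0 2 (ltW s0))); lra.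
    + exists (s * y); first by rewrite ge_min lexx orbT.
      by rewrite /q /= scalerA mulrN.
  have [/andP[r0 rH] pr pH [z xz pz]] := pP i ni; split => //.
  + by rewrite r0; lra.
  + by lra.
  + by exists z => //; rewrite ge_min xz.
- move=> i j /andP[ij]; rewrite ltnS leq_eqVlt => jn.
  have ni : (i < n)%N by case/predU1P: jn => [<-//|]; exact: ltn_trans.
  rewrite (ltn_eqF ni); case: eqVneq jn => [_ _|_ /= jn].
    rewrite gt_max qy// andbT; have [/andP[_ rH] _ _ _] := pP i ni.
    by apply: le_lt_trans rH _; apply: lt_trans Hs _; exact: qy.
  by apply: pd; rewrite ij.
Unshelve. all: by end_near. Qed.

Lemma no_corner : False.
Proof.
have [C BC] := BCP_bound d_homogeneous d_BCP.
have [p [r [x [H [_ _ pP pd]]]]] := corner_chain C.+1.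
suff : (C.+1 <= C)%N by rewrite ltnn.
by apply: (BC _ p r) => // i /pP[/andP[]].
Qed.

End Corner.

(** Since [phi 0] is the maximum, only a one-sided cone bound is at stake; its failure gives a
    corner of slope [c / 2]. *)
Lemma profile_flat0 : differentiable phi 0 /\ gradient phi 0 = 0.
Proof.
have [dphi d0] : differentiable phi 0 /\
    'd phi (0 : 'rV[R]_2) = (fun=> 0) :> ('rV[R]_2 -> R).
  apply: differentiable_flat => c c0; apply: contrapT => ncone.
  have [|e corner] := @corner_direction c c0.
    apply: contra_not ncone => cone; near=> v; rewrite addr0.
    rewrite distrC ger0_norm; first by near: v.
    rewrite subr_ge0; apply: (profile_max d_homogeneous phi_profile d_BCP).
    by near: v; exact: shadow_nbhs0.
  by apply: (@no_corner e (c / 2)) => //; rewrite divr_gt0.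
split=> //; apply/rowP => i; rewrite !mxE deriveE//.
by rewrite d0.
Unshelve. all: by end_near. Qed.

End Pole.

(** * The exceptional set and the slope bounds off it *)

Theorem theorem1p5 (R : realType) (d : Heis R -> Heis R -> R)
    (phi : 'rV[R]_2 -> R) (d_homogeneous : homogeneous_distance d)
    (phi_profile : is_profile d phi) (d_BCP : BCP d) :
  (exists W : set 'rV[R]_2,
    [/\ W `<=` unit_circle R, countable W, closed W &
      exists O : nat -> set 'rV[R]_2,
        [/\ forall j, rel_open (unit_circle R) (O j),
            unit_circle R `\` W = \bigcup_j O j &
            forall j, exists m alpha : R,
              [/\ 0 < m, 0 < alpha < pi / 2 &
                forall v : 'rV[R]_2,
                  (shadow d)° v -> v != 0 -> differentiable phi v ->
                  O j ((enorm v)^-1 *: v) ->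
                  forall w : 'rV[R]_2, w != 0 ->
                    angle v w <= alpha ->
                    dot (gradient phi v) w <= - m * enorm v * enorm w]]]) /\
  [/\ shadow d 0,
      forall v, shadow d v -> phi v <= phi 0,
      differentiable phi 0 &
      gradient phi 0 = 0].
Proof.
(* Directions missed by all regions of steepness are transverse for one of the two signs. *)
have fW : finite_set (unit_circle R `\` \bigcup_n steep_region d phi n.+1).
  apply: (@sub_finite_set _ _
    (transverse_dirs d phi 1 `|` transverse_dirs d phi (-1))).
    move=> e [e1 eW]; apply: (steep_or_transverse d_homogeneous phi_profile d_BCP e1).
    by move=> n en; apply: eW; exists n.
  by rewrite finite_setU; split; apply: finite_transverse;
    rewrite // ?mulrNN mulr1.
split; last first.
  have [dphi0 grad0] := profile_flat0 d_homogeneous phi_profile d_BCP.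
  split=> //; first exact: shadow0.
  by move=> v; exact: profile_max.
exists (unit_circle R `\` \bigcup_n steep_region d phi n.+1); split.
- exact: subDsetl.
- exact: finite_set_countable.
- apply: (accessible_finite_set_closed.1 _ _ fW).
  exact/hausdorff_accessible/norm_hausdorff.
exists (fun j => unit_circle R `&` steep_region d phi j.+1); split.
- move=> j; exists (steep_region d phi j.+1) => //.
  by apply: bigcup_open => U [].
- by rewrite setDD setI_bigcupr.
(* Both constants are [1 / (j + 2)]; the shift makes the angle less than 1, which is at most
   [pi / 2]. *)
- move=> j; exists (harmonic j.+1), (harmonic j.+1); split.
  + by rewrite /harmonic invr_gt0.
  + rewrite {1}/harmonic invr_gt0 ltr0n/=.
    apply: (@lt_le_trans _ _ 1); last exact: pihalf_ge1.
    by rewrite /harmonic invf_lt1// ltr1n.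
  + by move=> v Kv v0 dv [_ [U [_ steepU] Uv]]; exact: steepU.
Qed.
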